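(* Let $(M_1,g,J_1)$ be an almost Hermitian manifold, and let $M_2$ be a proper pointwise slant immersed submanifold of $(M_1,g,J_1)$ with slant function $\theta_1$. Let $J_2:=\sec\theta_1\cdot T_1$, where $T_1v$ denotes the component of $J_1v$ tangent to $M_2$ for $v$ tangent to $M_2$ (so that $(M_2,g,J_2)$ is an almost Hermitian manifold). Let $M_3$ be a pointwise slant immersed submanifold of $(M_2,g,J_2)$ with slant function $\theta_2$. Then $M_3$ is a pointwise slant submanifold of $(M_1,g,J_1)$, with slant function $$\tilde\theta_1=\arccos\big(\cos\theta_1\cos\theta_2\big).$$
   Context: An almost complex structure on a manifold is an endomorphism $J$ of the tangent bundle with $J^2=-I$; if it is skew-symmetric with respect to a Riemannian metric $g$, then $(g,J)$ is an almost Hermitian structure, and the manifold equipped with $(g,J)$ is an almost Hermitian manifold. All immersions are assumed injective, and the same symbol denotes a metric and the induced metric on a submanifold. In the formula, $\theta_1$ is restricted to $M_3$. An immersed submanifold $M$ of an almost Hermitian manifold $(\bar M,\bar g,\bar J)$ is a pointwise slant submanifold with slant function $\theta$, $\theta(x)\in(0,\frac{\pi}{2}]$ for all $x\in M$, if, for every $x\in M$ and every nonzero $v\in T_xM$, the angle between $\bar Jv$ and $T_xM$ does not depend on $v$ but only on $x$; its value is $\theta(x)$. Equivalently, if $Tv$ is the component of $\bar Jv$ tangent to $M$, then $\Vert Tv\Vert^2=\cos^2\theta(x)\Vert v\Vert^2$ for all $v\in T_xM$. It is a proper pointwise slant submanifold if moreover $\theta(x)\neq\frac{\pi}{2}$ for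 all $x\in M$. *)

(* Defs.v *)
From mathcomp Require Import all_boot all_order all_algebra.
From mathcomp Require Import all_classical all_reals all_analysis.

Set Implicit Arguments.
Unset Strict Implicit.
Unset Printing Implicit Defensive.

Import Order.TTheory GRing.Theory Num.Theory.
Import numFieldNormedType.Exports.

Local Open Scope classical_set_scope.
Local Open Scope ring_scope.

(* Meant for U open and V finite-dimensional, where asking that all directional
   derivatives be of class C^k is the same as asking that the differential be. *)
Fixpoint Ck_on (R : realType) (V W : normedModType R) (k : nat)
    (U : set V) (f : V -> W) : Prop :=
  match k with
  | 0%N => forall x, U x -> {for x, continuous f}
  | k'.+1 => (forall x, U x -> differentiable f x) /\
             (forall v : V, Ck_on k' U (fun x => 'D_v f x))
  end.

Definition smooth_on (R : realType) (V W : normedModType R)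
    (U : set V) (f : V -> W) : Prop :=
  forall k, Ck_on k U f.

Record chart (R : realType) (T : topologicalType) (n : nat) := Chart {
  chart_dom : set T ;
  chart_map :> T -> 'rV[R]_n ;
  chart_inv : 'rV[R]_n -> T ;
  chart_dom_open : open chart_dom ;
  chart_codom_open : open (chart_map @` chart_dom) ;
  chart_mapK : forall x, chart_dom x -> chart_inv (chart_map x) = x ;
  chart_map_continuous : {within chart_dom, continuous chart_map} ;
  chart_inv_continuous :
    {within chart_map @` chart_dom, continuous chart_inv}
}.

(* A smooth manifold without boundary, of dimension mdim. The atlas need not be
   maximal. The charts chart_at x only serve to represent tangent vectors. *)
Record manifold (R : realType) := Manifold {
  mcarrier :> topologicalType ;
  mdim : nat ;
  atlas : set (chart R mcarrier mdim) ;
  chart_at : mcarrier -> chart R mcarrier mdim ;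
  chart_at_atlas : forall x, atlas (chart_at x) ;
  mem_chart_at : forall x, chart_dom (chart_at x) x ;
  atlas_compatible : forall c d, atlas c -> atlas d ->
    smooth_on (c @` (chart_dom c `&` chart_dom d)) (fun y => d (chart_inv c y)) ;
  manifold_hausdorff : hausdorff_space mcarrier ;
  manifold_second_countable : @second_countable mcarrier
}.

Definition smooth_map (R : realType) (M N : manifold R) (f : M -> N) : Prop :=
  continuous f /\
  forall (c : chart R M (mdim M)) (d : chart R N (mdim N)),
    atlas c -> atlas d ->
    smooth_on (c @` (chart_dom c `&` f @^-1` chart_dom d))
              (fun y => d (f (chart_inv c y))).

(* A tangent vector at x is given by its coordinates in the chart chart_at x. *)
Definition tangent (R : realType) (M : manifold R) (x : M) : normedModType R :=
  'rV[R]_(mdim M).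

Definition mdiff (R : realType) (M N : manifold R) (f : M -> N) (x : M)
    (v : tangent x) : tangent (f x) :=
  'd (fun y => chart_at (f x) (f (chart_inv (chart_at x) y)))
     (chart_at x x) v.

(* The tangent vector at x whose coordinates in the chart c are u, and the
   coordinates in the chart c of a tangent vector v at x. *)
Definition of_coord (R : realType) (M : manifold R) (c : chart R M (mdim M))
    (x : M) (u : 'rV[R]_(mdim M)) : tangent x :=
  'd (fun y => chart_at x (chart_inv c y)) (c x) u.

Definition to_coord (R : realType) (M : manifold R) (c : chart R M (mdim M))
    (x : M) (v : tangent x) : 'rV[R]_(mdim M) :=
  'd (fun y => c (chart_inv (chart_at x) y)) (chart_at x x) v.

Definition form_field (R : realType) (M : manifold R) :=
  forall x : M, tangent x -> tangent x -> R.

Definition endo_field (R : realType) (M : manifold R) :=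
  forall x : M, tangent x -> tangent x.

Definition riemannian_metric (R : realType) (M : manifold R)
    (g : form_field M) : Prop :=
  [/\ forall x (a : R) (u v w : tangent x),
        g x (a *: u + v) w = a * g x u w + g x v w,
      forall x (u v : tangent x), g x u v = g x v u,
      forall x (u : tangent x), u != 0 -> 0 < g x u u
    & forall c : chart R M (mdim M), atlas c ->
        forall u v : 'rV[R]_(mdim M),
        smooth_on (c @` chart_dom c)
          (fun y => let x := chart_inv c y in
                    g x (of_coord c x u) (of_coord c x v) : R^o)].

Definition almost_complex_structure (R : realType) (M : manifold R)
    (J : endo_field M) : Prop :=
  [/\ forall x (a : R) (u v : tangent x),
        J x (a *: u + v) = a *: J x u + J x v,
      forall c : chart R M (mdim M), atlas c ->
        forall u : 'rV[R]_(mdim M),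
        smooth_on (c @` chart_dom c)
          (fun y => let x := chart_inv c y in
                    to_coord c (J x (of_coord c x u)))
    & forall x (u : tangent x), J x (J x u) = - u].

Definition almost_hermitian (R : realType) (M : manifold R)
    (g : form_field M) (J : endo_field M) : Prop :=
  [/\ riemannian_metric g, almost_complex_structure J
    & forall x (u v : tangent x), g x (J x u) v = - g x u (J x v)].

Definition gnorm (R : realType) (M : manifold R) (g : form_field M)
    (x : M) (u : tangent x) : R :=
  Num.sqrt (g x u u).

(* The angle is pi / 2 if u = 0 or v = 0, since 0^-1 = 0 and acos 0 = pi / 2. *)
Definition vangle (R : realType) (M : manifold R) (g : form_field M)
    (x : M) (u v : tangent x) : R :=
  acos (g x u v / (gnorm g u * gnorm g v)).

Definition immersed_submanifold (R : realType) (M N : manifold R)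
    (i : M -> N) : Prop :=
  [/\ smooth_map i, injective i & forall x, injective (@mdiff R M N i x)].

Definition induced_metric (R : realType) (M N : manifold R)
    (g : form_field N) (i : M -> N) : form_field M :=
  fun x u v => g (i x) (mdiff i u) (mdiff i v).

(* The component of w tangent to M: the t in T_x M such that w - di(t) is
   g-orthogonal to di(T_x M), which is unique for i an immersion. *)
Definition tangential (R : realType) (M N : manifold R) (g : form_field N)
    (i : M -> N) (x : M) (w : tangent (i x)) : tangent x :=
  xget 0 [set t : tangent x |
            forall u : tangent x, g (i x) (w - mdiff i t) (mdiff i u) = 0].

Definition tangential_endo (R : realType) (M N : manifold R)
    (g : form_field N) (J : endo_field N) (i : M -> N) : endo_field M :=
  fun x v => tangential g (J (i x) (mdiff i v)).

(* The angle between a vector and its orthogonal projection on di(T_x M); it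
   is pi / 2 if the projection is zero. *)
Definition angle_to_tangent (R : realType) (M N : manifold R)
    (g : form_field N) (i : M -> N) (x : M) (w : tangent (i x)) : R :=
  vangle g w (mdiff i (tangential g w)).

Definition pointwise_slant (R : realType) (M N : manifold R)
    (g : form_field N) (J : endo_field N) (i : M -> N) (theta : M -> R) : Prop :=
  [/\ immersed_submanifold i,
      forall x, 0 < theta x <= pi / 2
    & forall x (v : tangent x), v != 0 ->
        angle_to_tangent g (J (i x) (mdiff i v)) = theta x].

Definition proper_pointwise_slant (R : realType) (M N : manifold R)
    (g : form_field N) (J : endo_field N) (i : M -> N) (theta : M -> R) : Prop :=
  pointwise_slant g J i theta /\ forall x, theta x <> pi / 2.

(* Main.v *)
Require Import Defs.
From HB Require Import structures.
From mathcomp Require Import all_boot all_order all_algebra.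
From mathcomp Require Import all_classical all_reals all_analysis.
Import Order.TTheory GRing.Theory Num.Theory.
Import numFieldNormedType.Exports.
Local Open Scope ring_scope.

(** The tangential statement is linear algebra in one tangent space. Let [w] be
    a nonzero vector tangent to M3, seen in T M2. Since J1 is an isometry, the
    slant condition says that the orthogonal projection T1 w of J1 w on T M2
    has norm cos theta1 * |w|; thus cos theta1 is the cosine of the angle
    between a vector and its projection, which is the ratio of their norms
    ([cos_angle_to_tangent]). Hence J2 = T1 / cos theta1 preserves norms, and
    the projection of J2 w on T M3 has norm cos theta2 * |w|. Projecting J1 w
    on T M3 can be done in two steps, through T M2; the first step gives
    T1 w = cos theta1 * J2 w, so the result has norm
    cos theta1 * cos theta2 * |w|, and |J1 w| = |w|.

    Two things must be supplied around this computation. Orthogonal projections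
    exist because a positive definite form on a finite-dimensional space
    represents every linear functional ([definite_form_represents]). And M3 is
    immersed in M1: the composite of the immersions is smooth, and its
    differential is the composite of the differentials. In charts both follow,
    by inserting a chart of M2 around the intermediate point, from the chain
    rule and from the stability of C^k maps under composition
    ([Ck_on_comp]). *)

Set Implicit Arguments.
Unset Strict Implicit.
Unset Printing Implicit Defensive.

(** * Maps of class C^k between normed spaces *)

(** Differentiability at [x] depends on the germ at [x] only: [g] has the same
    first-order expansion as [f]. *)
Lemma near_eq_differentiable (R : numFieldType) (V W : normedModType R)
    (f g : V -> W) (x : V) :
  {near x, f =1 g} -> differentiable f x -> differentiable g x.
Proof.
move=> fg df.
have fgx : f x = g x by exact: nbhs_singleton fg.
have gE : g \o shift x = cst (g x) + 'd f x +o_ 0 id.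
  apply/eqaddoP => /= e e0.
  have /eqaddoP/(_ e e0) := diff_locally df.
  have := fg; rewrite (near_shift 0 x) => fg0.
  apply: filterS2 fg0 => h /=; rewrite subr0 => fgh.
  by rewrite /= /cst !fctE /= -fgx -fgh.
apply/diff_locallyP; rewrite (diff_unique (diff_continuous df) gE); split=> //.
exact: diff_continuous.
Qed.

Section Ck.
Local Open Scope classical_set_scope.
Context (R : realType).
Implicit Types V W : normedModType R.

Lemma Ck_on_sub V W k (A B : set V) (f : V -> W) :
  A `<=` B -> Ck_on k B f -> Ck_on k A f.
Proof.
move=> AB; elim: k f => [|k IH] f /=; first by move=> h x /AB /h.
by move=> [df h]; split=> [x /AB /df //|v]; exact: IH.
Qed.

(** Being C^k is a local property; this lets the auxiliary chart of the
    intermediate manifold vary with the point when maps are composed. *)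
Lemma Ck_on_local V W k (U : set V) (f : V -> W) :
  (forall x, U x -> exists2 A : set V, A x & Ck_on k A f) -> Ck_on k U f.
Proof.
elim: k f => [|k IH] f /= h.
  by move=> x /h[A Ax]; apply.
split=> [x /h[A Ax [df _]]|v]; first exact: df.
by apply: IH => x /h[A Ax [_ /(_ v)]]; exists A.
Qed.

Lemma eq_Ck_on V W k (U : set V) (f g : V -> W) :
  open U -> {in U, f =1 g} -> Ck_on k U f -> Ck_on k U g.
Proof.
move=> oU; elim: k f g => [|k IH] f g fg /=.
  move=> h x Ux; have nfg : {near x, f =1 g}.
    apply: filterS (open_nbhs_nbhs (conj oU Ux)) => y Uy.
    by apply: fg; rewrite inE.
  rewrite /prop_for /continuous_at -(nbhs_singleton nfg).
  by apply: cvg_trans (h x Ux); apply: near_eq_cvg.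
have nfg x : U x -> {near x, f =1 g}.
  move=> Ux; apply: filterS (open_nbhs_nbhs (conj oU Ux)) => y Uy.
  by apply: fg; rewrite inE.
move=> [df h]; split=> [x Ux|v].
  exact: near_eq_differentiable (nfg x Ux) (df x Ux).
apply: IH (h v) => x; rewrite inE => Ux; exact: near_eq_derive (nfg x Ux).
Qed.

Lemma Ck_onW V W k (U : set V) (f : V -> W) : Ck_on k.+1 U f -> Ck_on k U f.
Proof.
elim: k f => [|k IH] f.
  by move=> [df _] x /df /differentiable_continuous.
by move=> [df h]; split=> // v; apply: IH.
Qed.

Lemma Ck_on_cst V W k (U : set V) (w : W) : Ck_on k U (fun=> w).
Proof.
elim: k w => [|k IH] w /=; first by move=> x _; exact: cst_continuous.
split=> [x _|v]; first exact: differentiable_cst.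
by under eq_fun do rewrite (derive_cst w); exact: IH.
Qed.

Lemma Ck_onD V W k (U : set V) (f g : V -> W) : open U ->
  Ck_on k U f -> Ck_on k U g -> Ck_on k U (f + g).
Proof.
move=> oU; elim: k f g => [|k IH] f g /=.
  by move=> hf hg x Ux; apply: continuousD; [exact: hf|exact: hg].
move=> [df hf] [dg hg]; split=> [x Ux|v].
  by apply: differentiableD; [exact: df|exact: dg].
apply: (@eq_Ck_on _ _ _ _ ('D_v f + 'D_v g)) => //; last exact: IH.
move=> x; rewrite inE => Ux; rewrite deriveD//.
- by apply: diff_derivable; exact: df.
- by apply: diff_derivable; exact: dg.
Qed.

Lemma Ck_on_sum V W k (U : set V) n (F : 'I_n -> V -> W) : open U ->
  (forall i, Ck_on k U (F i)) -> Ck_on k U (\sum_i F i).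
Proof.
move=> oU h; elim/big_ind : _ => [|f g hf hg|i _] //; first exact: Ck_on_cst.
exact: Ck_onD.
Qed.

Lemma Ck_on_coord V k (U : set V) m n (f : V -> 'M[R]_(m, n)) i j : open U ->
  Ck_on k U f -> Ck_on k U (fun x => f x i j).
Proof.
move=> oU; elim: k f => [|k IH] f /=.
  move=> hf x Ux.
  apply: (@continuous_comp _ _ _ f (fun M : 'M[R]_(m, n) => M i j)).
    exact: hf.
  exact: coord_continuous.
move=> [df hf]; split=> [x Ux|v].
  apply: (@differentiable_comp _ _ _ _ f (fun M : 'M[R]_(m, n) => M i j)).
    exact: df.
  exact: differentiable_coord.
apply: (eq_Ck_on oU) (IH _ (hf v)) => x; rewrite inE => Ux.
by rewrite derive_mx ?mxE//; apply: diff_derivable; exact: df.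
Qed.

(** Scaling is a continuous bilinear map, so the Leibniz rule is the chain rule
    for it and the pairing of [k] with [f]. *)
Lemma is_diff_scale V W (k : V -> R) (f : V -> W) x :
  differentiable k x -> differentiable f x ->
  is_diff x (fun y => k y *: f y)
    (fun v => k x *: 'd f x v + 'd k x v *: f x).
Proof.
move=> dk df.
have bil : bilinear_for
    (GRing.Scale.Law.clone _ _ *:%R _) (GRing.Scale.Law.clone _ _ *:%R _)
    (@GRing.scale R W).
  split=> [w|a] b y z /=; first by rewrite scalerDl scalerA.
  by rewrite scalerDr !scalerA mulrC.
pose B := bilinear_isBilinear.Build R R W W _ _ (@GRing.scale R W) bil.
pose S : {bilinear R -> W -> W} := HB.pack (@GRing.scale R W) B.
have cS : continuous (fun p : R * W => S p.1 p.2).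
  exact: scale_continuous.
have dS p := differentiable_bilin p cS.
have dp := differentiable_pair dk df.
have -> : (fun y => k y *: f y) =
    (fun p => S p.1 p.2) \o (fun y => (k y, f y)) by [].
apply: DiffDef; first exact: differentiable_comp.
by rewrite diff_comp// diff_bilin// diff_pair.
Qed.

Lemma derive_scale V W (k : V -> R) (f : V -> W) x v :
  differentiable k x -> differentiable f x ->
  'D_v (fun y => k y *: f y) x = k x *: 'D_v f x + 'D_v k x *: f x.
Proof.
move=> dk df; rewrite (deriveE v dk) (deriveE v df).
have [d dE] := is_diff_scale dk df.
by apply: etrans (deriveE v d) _; apply: (congr1 (fun h : V -> W => h v) dE).
Qed.

Lemma Ck_on_scale V W n (U : set V) (k : V -> R) (f : V -> W) : open U ->
  Ck_on n U k -> Ck_on n U f -> Ck_on n U (fun x => k x *: f x).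
Proof.
move=> oU; elim: n k f => [|n IH] k f.
  by move=> hf hg x Ux; apply: continuousZ; [exact: hf|exact: hg].
move=> Ck Cf; have [dk hk] := Ck; have [df hf] := Cf.
have dkf x (Ux : U x) := is_diff_scale (dk x Ux) (df x Ux).
split=> [x Ux|v]; first by have [] := dkf x Ux.
apply: (@eq_Ck_on _ _ _ _
  ((fun x => k x *: 'D_v f x) + (fun x => 'D_v k x *: f x))) => //.
  move=> x; rewrite inE => Ux; rewrite fctE.
  by rewrite (derive_scale _ (dk x Ux) (df x Ux)).
apply: Ck_onD => //; first exact: IH (Ck_onW Ck) (hf v).
exact: IH (hk v) (Ck_onW Cf).
Qed.

(** By induction on [k]: the chain rule writes the directional derivative of
    [g \o f] along [v] as the sum over [i] of the coordinate [('D_v f) 0 i]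
    times ['D_(e_i) g \o f]. The coordinates are C^k and so are, by induction, the
    composites. The domain of [g] has to be a space with coordinates, because
    [Ck_on] speaks of derivatives along fixed vectors only. *)
Lemma Ck_on_comp V W n k (U : set V) (A : set 'rV[R]_n)
    (f : V -> 'rV[R]_n) (g : 'rV[R]_n -> W) :
  open U -> U `<=` f @^-1` A ->
  Ck_on k U f -> Ck_on k A g -> Ck_on k U (g \o f).
Proof.
move=> oU UA; elim: k f g UA => [|k IH] f g UA.
  move=> hf hg x Ux; apply: continuous_comp; first exact: hf.
  by apply: hg; exact: UA.
move=> Cf Cg; have [df hf] := Cf; have [dg hg] := Cg.
split=> [x Ux|v].
  by apply: differentiable_comp; [exact: df|apply: dg; exact: UA].
apply: (@eq_Ck_on _ _ _ _
  (\sum_(i < n) (fun x => 'D_v f x 0 i *: ('D_(delta_mx 0 i) g \o f) x))) => //.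
  move=> x; rewrite inE => Ux; rewrite fct_sumE.
  have dfx := df x Ux; have dgx := dg _ (UA x Ux).
  rewrite [RHS]deriveE; last exact: differentiable_comp.
  rewrite diff_comp//= -(deriveE v dfx) [X in 'd g _ X]row_sum_delta.
  rewrite linear_sum; apply: eq_bigr => i _; rewrite linearZ /= (deriveE _ dgx).
  by congr (_ *: _).
apply: Ck_on_sum => // i; apply: Ck_on_scale => //.
  exact: Ck_on_coord oU (hf v).
exact: IH UA (Ck_onW Cf) (hg _).
Qed.
End Ck.

(** * Composition of smooth maps and of immersions *)

Section manifolds.
Context (R : realType).
Local Open Scope classical_set_scope.

(** The image is the preimage of [A] by the inverse of the chart, which is
    continuous on the open set [c @` chart_dom c]. *)
Lemma open_chart_image (M : manifold R) (c : chart R M (mdim M)) (A : set M) :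
  open A -> open (c @` (chart_dom c `&` A)).
Proof.
move=> oA.
have -> : c @` (chart_dom c `&` A) =
    (c @` chart_dom c) `&` (@chart_inv _ _ _ c @^-1` A).
  apply/seteqP; split=> [_ [x [cx Ax] <-]|_ [[x cx <-]]] /=.
    by split; [exists x|rewrite chart_mapK].
  by rewrite chart_mapK// => Ax; exists x.
have oc := @chart_codom_open _ _ _ c.
have := @chart_inv_continuous _ _ _ c.
rewrite continuous_open_subspace// => ic.
rewrite openE => y [cy Ay]; apply: filterI; first exact: open_nbhs_nbhs.
by apply: (ic y); [rewrite inE|exact: open_nbhs_nbhs].
Qed.

Section composition.
Context (M N P : manifold R) (f : M -> N) (g : N -> P).
Hypotheses (sf : smooth_map f) (sg : smooth_map g).

Lemma open_preimage_chart_doms (d : chart R N (mdim N))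
    (e : chart R P (mdim P)) :
  open (f @^-1` chart_dom d `&` (g \o f) @^-1` chart_dom e).
Proof.
have [[cf _] [cg _]] := (sf, sg).
apply: openI; apply: open_comp; try exact: chart_dom_open.
  by move=> x _; exact: cf.
by move=> x _; apply: continuous_comp; [exact: cf|exact: cg].
Qed.

(** Where the intermediate point lies in the domain of [d], the expression of
    [g \o f] in charts factors through [d]. *)
Lemma coord_comp (c : chart R M (mdim M)) (d : chart R N (mdim N))
    (e : chart R P (mdim P)) :
  {in c @` (chart_dom c `&`
        (f @^-1` chart_dom d `&` (g \o f) @^-1` chart_dom e)),
    (fun z => e (g (chart_inv d z))) \o (fun y => d (f (chart_inv c y)))
      =1 fun y => e (g (f (chart_inv c y)))}.
Proof.
move=> y; rewrite inE => -[x [cx [dfx _]] <-] /=.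
by rewrite (chart_mapK cx) (chart_mapK dfx).
Qed.

Lemma smooth_map_comp : smooth_map (fun x => g (f x)).
Proof.
have [[cf Sf] [cg Sg]] := (sf, sg).
split=> [x|c e ac ae k]; first by apply: continuous_comp; [exact: cf|exact: cg].
apply: Ck_on_local => _ [x [cx ex] <-].
(* Near [c x], the composite is read through the chart of N at [f x]. *)
pose d := chart_at (f x).
have ad : atlas d by exact: chart_at_atlas.
have dfx : chart_dom d (f x) by exact: mem_chart_at.
pose A := f @^-1` chart_dom d `&` (g \o f) @^-1` chart_dom e.
have oA : open (c @` (chart_dom c `&` A)).
  by apply: open_chart_image; exact: open_preimage_chart_doms.
exists (c @` (chart_dom c `&` A)); first by exists x.
apply: (eq_Ck_on oA (@coord_comp c d e)).
apply: (Ck_on_comp oA _ _ (Sg d e ad ae k)).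
  move=> _ [y [cy [dy ey]] <-] /=.
  by exists (f y) => //; rewrite chart_mapK.
apply: (Ck_on_sub _ (Sf c d ac ad k)).
by move=> _ [y [cy [dy ey]] <-]; exists y.
Qed.

Lemma mdiff_comp x (v : tangent x) :
  mdiff (fun x => g (f x)) v = mdiff g (mdiff f v).
Proof.
have [[cf Sf] [cg Sg]] := (sf, sg).
rewrite /mdiff.
set c := chart_at x; set d := chart_at (f x); set e := chart_at (g (f x)).
have cx : chart_dom c x by exact: mem_chart_at.
have dfx : chart_dom d (f x) by exact: mem_chart_at.
have egfx : chart_dom e (g (f x)) by exact: mem_chart_at.
have [df _] := Sf c d (chart_at_atlas _) (chart_at_atlas _) 1%N.
have [dg _] := Sg d e (chart_at_atlas _) (chart_at_atlas _) 1%N.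
have {}df : differentiable (fun y => d (f (chart_inv c y))) (c x).
  by apply: df; exists x.
have {}dg : differentiable (fun z => e (g (chart_inv d z))) (d (f x)).
  by apply: dg; exists (f x).
have near_comp : {near c x,
    (fun z => e (g (chart_inv d z))) \o (fun y => d (f (chart_inv c y)))
      =1 fun y => e (g (f (chart_inv c y)))}.
  have oA := @open_chart_image _ c _ (open_preimage_chart_doms d e).
  apply: filterS (open_nbhs_nbhs (conj oA _)).
    by move=> y Ay; apply: (@coord_comp c d e); rewrite inE.
  by exists x.
have fcx : d (f (chart_inv c (c x))) = d (f x) by rewrite chart_mapK.
have dg' : differentiable (fun z => e (g (chart_inv d z)))
    ((fun y => d (f (chart_inv c y))) (c x)) by rewrite fcx.
have dgf := differentiable_comp df dg'.
rewrite -(deriveE _ (near_eq_differentiable near_comp dgf)).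
rewrite -(near_eq_derive _ near_comp) (deriveE _ dgf).
by rewrite (diff_comp df dg') /= fcx.
Qed.

Lemma immersed_submanifold_comp :
  immersed_submanifold f -> immersed_submanifold g ->
  immersed_submanifold (fun x => g (f x)).
Proof.
move=> [_ If idf] [_ Ig idg]; split; first exact: smooth_map_comp.
  by move=> x y /Ig/If.
by move=> x u v; rewrite !mdiff_comp => /idg/idf.
Qed.

End composition.
End manifolds.

(** * Positive definite bilinear forms *)

Section linear_algebra.
Context (R : realType) (m : nat).

Lemma scalar_row_sum (l : 'rV[R]_m -> R) (u : 'rV[R]_m) :
  scalar l -> l u = \sum_j u 0 j * l (delta_mx 0 j).
Proof.
move=> ll; pose L : {scalar 'rV[R]_m} :=
  HB.pack l (GRing.isLinear.Build _ _ _ _ _ ll).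
rewrite -[l]/(L : _ -> _) {1}(row_sum_delta u) linear_sum.
by apply: eq_bigr => j _; rewrite linearZ.
Qed.

(** The Gram matrix of the canonical basis is invertible, since a vector of its
    kernel is orthogonal to itself; inverting it solves for [t]. *)
Lemma definite_form_represents (h : 'rV[R]_m -> 'rV[R]_m -> R)
    (l : 'rV[R]_m -> R) :
  (forall w, scalar (h^~ w)) -> (forall u, scalar (h u)) ->
  (forall u, u != 0 -> 0 < h u u) -> scalar l ->
  exists t, forall u, h t u = l u.
Proof.
move=> hl hr hpos ll.
pose S := \matrix_(i, j) h (delta_mx 0 i) (delta_mx 0 j) : 'M[R]_m.
have tS t j : (t *m S) 0 j = h t (delta_mx 0 j).
  rewrite mxE (scalar_row_sum t (hl _)).
  by apply: eq_bigr => i _; rewrite mxE.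
have hS t u : h t u = \sum_j u 0 j * (t *m S) 0 j.
  by rewrite (scalar_row_sum u (hr t)); apply: eq_bigr => j _; rewrite tS.
have Su : S \in unitmx.
  rewrite -row_free_unit; apply: inj_row_free => t tS0.
  apply/eqP; apply: contraT => /hpos; rewrite hS tS0.
  by rewrite big1 ?ltxx// => j _; rewrite mxE mulr0.
exists ((\row_j l (delta_mx 0 j)) *m invmx S) => u.
rewrite hS mulmxKV// (scalar_row_sum u ll).
by apply: eq_bigr => j _; rewrite mxE.
Qed.

End linear_algebra.

(** * Orthogonal projection on the tangent space of a submanifold *)

Section fibers.
Context (R : realType).

(** The pointwise part of a Riemannian metric, which an induced metric inherits
    fibre by fibre from the injectivity of the differential. *)
Definition fiberwise_inner_product (M : manifold R) (g : form_field M) :=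
  [/\ forall x (w : tangent x), scalar (fun u : tangent x => g x u w),
      forall x (u v : tangent x), g x u v = g x v u
    & forall x (u : tangent x), u != 0 -> 0 < g x u u].

Section inner_product.
Context (M : manifold R) (g : form_field M) (hg : fiberwise_inner_product g).
Arguments g : clear implicits.
Context (x : M).
Implicit Types u v w : tangent x.

Lemma form_linearl w : scalar (fun u => g x u w).
Proof. by have [gl _ _] := hg; move=> ?; exact: gl. Qed.

Lemma form_sym u v : g x u v = g x v u.
Proof. by have [_ gs _] := hg. Qed.

Lemma form_linearr u : scalar (g x u).
Proof. by move=> a v w; rewrite !(form_sym u) form_linearl. Qed.

Lemma formBl u v w : g x (u - v) w = g x u w - g x v w.
Proof. by rewrite -scaleN1r addrC form_linearl mulN1r addrC. Qed.

Lemma form0l w : g x 0 w = 0.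
Proof. by rewrite -(subrr 0) formBl subrr. Qed.

Lemma formNl u w : g x (- u) w = - g x u w.
Proof. by rewrite -sub0r formBl form0l sub0r. Qed.

Lemma formDl u v w : g x (u + v) w = g x u w + g x v w.
Proof. by rewrite -[u]scale1r form_linearl mul1r scale1r. Qed.

Lemma formZl a u w : g x (a *: u) w = a * g x u w.
Proof. by rewrite -[_ *: _]addr0 form_linearl form0l addr0. Qed.

Lemma form_ge0 u : 0 <= g x u u.
Proof.
have [_ _ gp] := hg; have [->|/gp/ltW//] := eqVneq u 0.
by rewrite form0l.
Qed.

Lemma form_eq0 u : g x u u = 0 -> u = 0.
Proof.
move=> u0; apply/eqP; apply: contraT => un0.
by have [_ _ /(_ _ _ un0)] := hg; rewrite u0 ltxx.
Qed.

Lemma form_gnormE u : g x u u = Defs.gnorm g u ^+ 2.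
Proof. by rewrite sqr_sqrtr// form_ge0. Qed.

Lemma gnorm_ge0 u : 0 <= Defs.gnorm g u. Proof. exact: sqrtr_ge0. Qed.

Lemma gnorm_gt0 u : u != 0 -> 0 < Defs.gnorm g u.
Proof. by have [_ _ gp] := hg; move=> /gp; rewrite sqrtr_gt0. Qed.

Lemma gnormZ a u : 0 <= a -> Defs.gnorm g (a *: u) = a * Defs.gnorm g u.
Proof.
move=> a0; rewrite /Defs.gnorm formZl form_sym formZl mulrA -expr2.
by rewrite sqrtrM ?sqr_ge0// sqrtr_sqr ger0_norm.
Qed.

End inner_product.

Lemma mdiff_linear (M N : manifold R) (i : M -> N) (x : M) :
  linear (@mdiff R M N i x).
Proof. by move=> a u v; rewrite /mdiff linearP. Qed.

Lemma mdiffB (M N : manifold R) (i : M -> N) (x : M) (u v : tangent x) :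
  mdiff i (u - v) = mdiff i u - mdiff i v.
Proof. exact: linearB. Qed.

Lemma mdiffZ (M N : manifold R) (i : M -> N) (x : M) a (u : tangent x) :
  mdiff i (a *: u) = a *: mdiff i u.
Proof. by rewrite /mdiff linearZ. Qed.

Lemma mdiff0 (M N : manifold R) (i : M -> N) (x : M) :
  mdiff i (0 : tangent x) = 0.
Proof. exact: linear0. Qed.

Section immersion.
Context (M N : manifold R) (g : form_field N) (i : M -> N).
Arguments g : clear implicits.
Hypotheses (hg : fiberwise_inner_product g)
  (inj_di : forall x, injective (@mdiff R M N i x)).

Lemma mdiff_neq0 x (u : tangent x) : u != 0 -> mdiff i u != 0.
Proof.
by apply: contra_neq => u0; apply: inj_di; rewrite u0 mdiff0.
Qed.

Lemma induced_inner_product : fiberwise_inner_product (induced_metric g i).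
Proof.
split=> [x w a u v|x u v|x u u0]; rewrite /induced_metric.
- by rewrite mdiff_linear form_linearl.
- by rewrite form_sym.
- by have [_ _ gp] := hg; apply: gp; exact: mdiff_neq0.
Qed.

(** Two such vectors [t] have a difference that is orthogonal to itself for the
    induced metric. *)
Lemma tangential_unique x (w : tangent (i x)) (t : tangent x) :
  (forall u : tangent x, g (i x) (w - mdiff i t) (mdiff i u) = 0) ->
  tangential g w = t.
Proof.
move=> ht; rewrite /tangential.
case: xgetP => [s _ /= hs|/(_ t)]; last by [].
suff : s - t = 0 by move/subr0_eq.
apply: (form_eq0 induced_inner_product).
rewrite /induced_metric mdiffB.
have {1}-> : mdiff i s - mdiff i t = (w - mdiff i t) - (w - mdiff i s).
  by rewrite opprB [RHS]addrC addrA subrK.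
by rewrite (formBl hg) -mdiffB ht hs subrr.
Qed.

(** The projection exists: it represents the functional
    [u |-> g w (di u)] for the induced metric, which is positive definite as [i]
    is an immersion. *)
Lemma tangentialP x (w : tangent (i x)) (u : tangent x) :
  g (i x) (w - mdiff i (tangential g w)) (mdiff i u) = 0.
Proof.
have hg2 := induced_inner_product.
have [t ht] : exists t : tangent x, forall u : tangent x,
    induced_metric g i t u = g (i x) w (mdiff i u).
  apply: definite_form_represents.
  - exact: form_linearl.
  - exact: form_linearr.
  - by have [_ _] := hg2; apply.
  - by move=> a y z; rewrite mdiff_linear form_linearr.
have {}ht y : g (i x) (w - mdiff i t) (mdiff i y) = 0.
  by rewrite formBl// -ht subrr.
by rewrite (tangential_unique ht).
Qed.

(** For the projection [p] of [w], [g w p = g p p], so that the cosine of the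
    angle simplifies to [|p| / |w|]; Pythagoras bounds this by 1, so that it lies
    where [cos] inverts [acos]. *)
Lemma angle_to_tangentE x (w : tangent (i x)) : w != 0 ->
  let r := Defs.gnorm g (mdiff i (tangential g w)) / Defs.gnorm g w in
  0 <= r <= 1 /\ angle_to_tangent g w = acos r.
Proof.
move=> w0 /=; set p := mdiff i _.
have wp0 : g (i x) (w - p) p = 0 by exact: tangentialP.
have wp : g (i x) w p = g (i x) p p.
  by apply/eqP; rewrite -subr_eq0 -(formBl hg) wp0.
have nw : 0 < Defs.gnorm g w by exact: gnorm_gt0.
split.
  rewrite divr_ge0 ?gnorm_ge0//= ler_pdivrMr// mul1r.
  rewrite ler_sqrt ?form_ge0//.
  rewrite -subr_ge0; suff -> : g (i x) w w - g (i x) p p =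
    g (i x) (w - p) (w - p) by exact: form_ge0.
  rewrite [RHS](formBl hg) (form_sym hg w) (form_sym hg p (w - p)) wp0 subr0.
  by rewrite (formBl hg) (form_sym hg p w) wp.
rewrite /angle_to_tangent /vangle -/p wp (form_gnormE hg); congr acos.
(* If [p = 0], both quotients are 0. *)
have [->|np0] := eqVneq (Defs.gnorm g p) 0; first by rewrite expr0n !mul0r.
by rewrite expr2 invfM mulrA mulrAC mulfK.
Qed.

Lemma cos_angle_to_tangent x (w : tangent (i x)) : w != 0 ->
  Defs.gnorm g (mdiff i (tangential g w)) =
    cos (angle_to_tangent g w) * Defs.gnorm g w.
Proof.
move=> w0; have [/andP[r0 r1] ->] := angle_to_tangentE w0.
rewrite acosK; last by rewrite in_itv /= r1 (le_trans _ r0)// lerN10.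
by rewrite divfK// gt_eqF// gnorm_gt0.
Qed.

End immersion.

Lemma acos_bounds (a : R) : 0 <= a < 1 -> 0 < acos a <= pi / 2.
Proof.
move=> /andP[a0 a1]; have aN : -1 <= a by rewrite (le_trans _ a0)// lerN10.
rewrite acos_gt0 ?aN//= -(acos0 R) leNgt; apply/negP => lt_acos.
move: lt_acos; rewrite -ltr_cos ?in_itv /=
  ?acos_ge0 ?acos_lepi ?lerN10 ?ler01 ?aN ?(ltW a1)//.
rewrite !acosK ?in_itv /= ?lerN10 ?ler01 ?aN ?(ltW a1)//.
by rewrite ltNge a0.
Qed.

Lemma almost_hermitian_inner_product (M : manifold R) (g : form_field M)
    (J : endo_field M) : almost_hermitian g J -> fiberwise_inner_product g.
Proof.
by case=> -[gl gs gp _] _ _; split=> // x w a u v; exact: gl.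
Qed.

(** J is skew-symmetric and squares to -1, hence is an isometry. *)
Lemma gnorm_almost_complex (M : manifold R) (g : form_field M)
    (J : endo_field M) (x : M) (u : tangent x) :
  almost_hermitian g J -> Defs.gnorm g (J x u) = Defs.gnorm g u.
Proof.
move=> hJ; have hg := almost_hermitian_inner_product hJ.
case: hJ => _ [_ _ JJ] gJ; congr Num.sqrt.
by rewrite gJ JJ (form_sym hg) (formNl hg) opprK.
Qed.

End fibers.

Theorem theorem4p2 (R : realType) (M1 M2 M3 : manifold R)
    (g : form_field M1) (J1 : endo_field M1)
    (i2 : M2 -> M1) (i3 : M3 -> M2)
    (theta1 : M2 -> R) (theta2 : M3 -> R)
    (hM1 : almost_hermitian g J1)
    (hM2 : proper_pointwise_slant g J1 i2 theta1) :
  let g2 : form_field M2 := induced_metric g i2 in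
  let T1 : endo_field M2 := tangential_endo g J1 i2 in
  let J2 : endo_field M2 := fun x v => (cos (theta1 x))^-1 *: T1 x v in
  pointwise_slant g2 J2 i3 theta2 ->
  pointwise_slant g J1 (fun x => i2 (i3 x))
    (fun x => acos (cos (theta1 (i3 x)) * cos (theta2 x))).
Proof.
move=> g2 T1 J2 [imm3 th2 slant3].
have [[imm2 th1 slant2] proper2] := hM2.
have hg := almost_hermitian_inner_product hM1.
have [sm2 _ inj2] := imm2; have [sm3 _ inj3] := imm3.
have hg2 : fiberwise_inner_product g2 by exact: induced_inner_product.
have imm : immersed_submanifold (fun x => i2 (i3 x)).
  exact: immersed_submanifold_comp.
have [_ _ inj23] := imm.
have cos1_gt0 x : 0 < cos (theta1 x).
  have /andP[th_gt0 th_le] := th1 x; apply: cos_gt0_pihalf.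
  rewrite (lt_trans _ th_gt0) ?oppr_lt0 ?divr_gt0 ?pi_gt0//= lt_neqAle th_le.
  by rewrite andbT; apply/eqP; exact: proper2.
have cos1_lt1 x : cos (theta1 x) < 1.
  have /andP[th_gt0 th_le] := th1 x.
  rewrite -cos0 ltr_cos// in_itv /= ?lexx ?pi_ge0// ltW//= (le_trans th_le)//.
  by rewrite ler_pdivrMr// ler_peMr ?pi_ge0// ler1n.
have cos2_ge0 x : 0 <= cos (theta2 x).
  have /andP[th_gt0 th_le] := th2 x; apply: cos_ge0_pihalf.
  by rewrite th_le andbT (le_trans _ (ltW th_gt0))// oppr_le0 divr_ge0 ?pi_ge0.
split=> // [x|x v v0].
  apply: acos_bounds; rewrite mulr_ge0 ?(ltW (cos1_gt0 _))//=.
  by rewrite (le_lt_trans _ (cos1_lt1 (i3 x)))// ler_piMr ?cos_le1// ltW.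
pose w := mdiff i3 v; pose c := cos (theta1 (i3 x)).
have w0 : w != 0 by exact: mdiff_neq0.
have c0 : c != 0 by rewrite gt_eqF// cos1_gt0.
have Jgnorm := @gnorm_almost_complex _ _ _ _ _ _ hM1.
pose Jw := J1 (i2 (i3 x)) (mdiff i2 w).
have nJw : Defs.gnorm g Jw = Defs.gnorm g2 w by rewrite Jgnorm.
have Jw0 : Jw != 0.
  apply: contraTneq (gnorm_gt0 hg2 w0); rewrite -nJw => ->.
  by rewrite /Defs.gnorm (form0l hg) sqrtr0 ltxx.
(* [slant2] and [slant3] are used through norms: |T1 w| = c |w|, so that J2
   preserves the norm of [w]. *)
have nT1 : Defs.gnorm g2 (T1 _ w) = c * Defs.gnorm g2 w.
  by rewrite -nJw -[c](congr1 cos (slant2 _ _ w0)) -cos_angle_to_tangent.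
have T1E : T1 _ w = c *: J2 _ w by rewrite scalerA divff// scale1r.
have nJ2 : Defs.gnorm g2 (J2 _ w) = Defs.gnorm g2 w.
  apply: (mulfI c0); by rewrite -nT1 T1E [RHS](gnormZ hg2 _ (ltW (cos1_gt0 _))).
have J20 : J2 _ w != 0.
  apply: contraTneq (gnorm_gt0 hg2 w0); rewrite -nJ2 => ->.
  by rewrite /Defs.gnorm (form0l hg2) sqrtr0 ltxx.
pose t := tangential g2 (J2 (i3 x) w).
have nt : Defs.gnorm g2 (mdiff i3 t) = cos (theta2 x) * Defs.gnorm g2 w.
  by rewrite (cos_angle_to_tangent hg2 inj3 J20) nJ2 (slant3 _ _ v0).
(* Projecting J1 w on T M3 in two steps: J1 w - di(ct) is the sum of the part of
   J1 w normal to M2 and of c times the part of J2 w normal to M3. *)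
have tanE : @tangential _ _ _ g (fun x => i2 (i3 x)) x Jw = c *: t.
  apply: tangential_unique => // u; rewrite !(mdiff_comp sm3 sm2) mdiffZ.
  rewrite -(subrK (mdiff i2 (T1 _ w)) Jw) -addrA (formDl hg).
  rewrite [X in X + _](tangentialP hg inj2) add0r -mdiffB T1E -scalerBr mdiffZ.
  rewrite (formZl hg) -[X in c * X]/(g2 _ _ _).
  by rewrite (tangentialP hg2 inj3) mulr0.
have [_] := @angle_to_tangentE _ _ _ _ _ hg inj23 x Jw Jw0.
rewrite tanE !(mdiff_comp sm3 sm2) [mdiff i3 (c *: t)]mdiffZ -/w => ->.
congr acos.
have -> : Defs.gnorm g (mdiff i2 (c *: mdiff i3 t)) =
    c * Defs.gnorm g2 (mdiff i3 t).
  exact: (gnormZ hg2 _ (ltW (cos1_gt0 (i3 x)))).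
by rewrite nJw nt mulrA mulfK// gt_eqF// gnorm_gt0.
Qed.
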